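(* Let $b>0$ and let $n$ be a positive integer. Then $$\int_{0}^{b} \frac{\ln t \, dt}{(1+t)^{n+1}} = \frac{1}{n} \left[ 1 - (1+b)^{-n} \right] \ln b - \frac{1}{n} \ln(1+b) - \frac{1}{n (1+b)^{n-1}} \sum_{j=1}^{n-1} \frac{1}{j!} \binom{n-1}{j} |s(j+1,2)|\, b^{j},$$ where $s(\cdot,\cdot)$ denotes the Stirling numbers of the first kind.
   Context: The signed Stirling numbers of the first kind $s(n,j)$ are defined by $x(x-1)\cdots(x-n+1)=\sum_{j=1}^n s(n,j)x^j$ for $n\ge1$; their absolute values $|s(n,j)|=(-1)^{n+j}s(n,j)$ are the coefficients of $x(x+1)\cdots(x+n-1)$. Empty sums are $0$. *)

(* Defs.v *)
From mathcomp Require Import all_boot all_order all_algebra.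

Set Implicit Arguments.
Unset Strict Implicit.
Unset Printing Implicit Defensive.

Import GRing.Theory.
Local Open Scope ring_scope.

(* Signed: the coefficient of 'X^j in x (x - 1) ... (x - n + 1). *)
Definition stirling1 (n j : nat) : int :=
  (\prod_(i < n) ('X - (i%:R)%:P) : {poly int})`_j.

(* Main.v *)
(** The integral of ln t / (1 + t)^(n+1) over ]0, b] is the difference of those
    of ln b / (1 + t)^(n+1) and of (ln b - ln t) / (1 + t)^(n+1), each of constant
    sign on ]0, b]; for such integrands the fundamental theorem of calculus
    extends to the singular endpoint 0 by monotone convergence.
    Since |s(j+1, 2)| = j! H_j, with H_j the j-th harmonic number, the sum in
    the statement is S(b) for S = \sum_j C(n-1, j) H_j X^j, and the antiderivative
    comes from the identity X ((1 + X) S' - (n-1) S) = (1 + X)^(n-1) - 1. *)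
Require Import Defs.
From mathcomp Require Import all_boot all_order all_algebra.
From mathcomp Require Import all_classical all_reals all_analysis.
From mathcomp Require Import measurable_realfun ring lra.

Import Order.TTheory GRing.Theory Num.Theory.
Import numFieldNormedType.Exports.
Local Open Scope classical_set_scope.
Local Open Scope ring_scope.

(** * Stirling numbers of the first kind *)

Lemma stirling1S n j :
  stirling1 n.+1 j.+1 = stirling1 n j - stirling1 n j.+1 * n%:R.
Proof.
by rewrite /stirling1 big_ord_recr/= mulrBr coefB coefMX coefMC.
Qed.

Lemma stirling1S0 n : stirling1 n.+1 0 = 0.
Proof.
by rewrite /stirling1 big_ord_recl/= subr0 coefXM.
Qed.

Lemma stirling1S1 n : stirling1 n.+1 1 = (-1) ^+ n * n`!%:R.
Proof.
elim: n => [|n IHn].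
  by rewrite stirling1S /stirling1 big_ord0 !coefE/= mulr0 subr0 mulr1.
by rewrite stirling1S stirling1S0 IHn factS natrM exprS; ring.
Qed.

(** * Harmonic numbers and their binomial generating polynomial *)

Section binomial_harmonic_poly.
Variable R : numFieldType.

Definition harmonic_number (n : nat) : R := \sum_(k < n) k.+1%:R^-1.

Lemma harmonic_numberS n :
  harmonic_number n.+1 = harmonic_number n + n.+1%:R^-1.
Proof. by rewrite /harmonic_number big_ord_recr. Qed.

(** Dividing the recurrence for $s(n+2,2)$ by $(-1)^n (n+1)!$, with $s(n+1,1) = (-1)^n n!$, turns it
    into $H_{n+1} = H_n + 1/(n+1)$. *)
Lemma stirling1S2 n :
  (stirling1 n.+1 2)%:~R = (-1) ^+ n.+1 * (n`!%:R * harmonic_number n).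
Proof.
elim: n => [|n IHn].
  rewrite stirling1S /stirling1 big_ord0 !coefE/= mulr0 subr0.
  by rewrite /harmonic_number big_ord0 !mulr0.
have n1 : n.+1%:R != 0 :> R by rewrite pnatr_eq0.
rewrite stirling1S stirling1S1 rmorphB !rmorphM/= IHn rmorphXn rmorphN1.
rewrite harmonic_numberS factS natrM !rmorph_nat !exprS.
by field.
Qed.

Lemma harmonic_number_ge0 n : 0 <= harmonic_number n.
Proof. by apply: sumr_ge0 => i _; rewrite invr_ge0 ler0n. Qed.

Lemma abs_stirling1S2 n :
  `|stirling1 n.+1 2|%:~R = n`!%:R * harmonic_number n.
Proof.
rewrite intr_norm stirling1S2 normrM normrX normrN1 expr1n mul1r.
by rewrite ger0_norm// mulr_ge0 ?ler0n ?harmonic_number_ge0.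
Qed.

Definition binomial_harmonic (m : nat) : {poly R} :=
  \poly_(j < m.+1) ('C(m, j)%:R * harmonic_number j).

Lemma coef_binomial_harmonic m j :
  (binomial_harmonic m)`_j = 'C(m, j)%:R * harmonic_number j.
Proof.
by rewrite coef_poly; case: ltnP => // mj; rewrite bin_small// mul0r.
Qed.

(** Coefficientwise: in degree $j+1$, the absorption identity $(j+1) C(m,j+1) = (m-j) C(m,j)$
    cancels every multiple of $H_j$, and the increment $H_{j+1} - H_j$ leaves $C(m,j+1)$. *)
Lemma binomial_harmonic_deriv m :
  'X * ((1 + 'X) * (binomial_harmonic m)^`() - m%:R *: binomial_harmonic m) =
  (1 + 'X) ^+ m - 1 :> {poly R}.
Proof.
have coefX1 j : ((1 + 'X) ^+ m : {poly R})`_j = 'C(m, j)%:R.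
  rewrite exprDn; under eq_bigr do rewrite expr1n mul1r -scaler_nat.
  rewrite -(poly_def _ (fun i => 'C(m, i)%:R)) coef_poly.
  by case: ltnP => // mj; rewrite bin_small.
apply/polyP => -[|j]; rewrite [RHS]coefB coefX1 coef1 coefXM/=.
  by rewrite bin0 subrr.
rewrite coefB mulrDl mul1r coefD coefXM coefZ !coef_deriv.
(* The case split of the shift by ['X] is absorbed by the factor [j%:R], which vanishes at
   [j = 0]. *)
have -> : (if j == 0%N then 0 else (binomial_harmonic m)`_j.-1.+1 *+ j.-1.+1)
   = (binomial_harmonic m)`_j * j%:R.
  by case: j => [|j]; rewrite ?mulr0// mulr_natr.
rewrite !coef_binomial_harmonic harmonic_numberS subr0.
(* The difference is taken in [R], not truncated; for [j > m] both binomials are 0. *)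
have binS : 'C(m, j.+1)%:R * j.+1%:R = (m%:R - j%:R) * 'C(m, j)%:R :> R.
  have [jm|mj] := leqP j m; last by rewrite !bin_small ?mulr0 ?mul0r// ltnW.
  by rewrite -natrM mulnC mul_bin_left natrM natrB.
have j1 : j.+1%:R != 0 :> R by rewrite pnatr_eq0.
have -> : 'C(m, j.+1)%:R * (harmonic_number j + j.+1%:R^-1) *+ j.+1 =
    (m%:R - j%:R) * 'C(m, j)%:R * harmonic_number j + 'C(m, j.+1)%:R.
  by rewrite -[LHS]mulr_natr [LHS]mulrAC mulrDr mulfK// binS.
ring.
Qed.

Lemma horner_binomial_harmonic m x :
  (binomial_harmonic m).[x] =
  \sum_(1 <= j < m.+1) 'C(m, j)%:R * harmonic_number j * x ^+ j.
Proof.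
rewrite horner_poly -(big_mkord xpredT
  (fun j => 'C(m, j)%:R * harmonic_number j * x ^+ j)).
by rewrite big_ltn// /harmonic_number big_ord0 mulr0 mul0r add0r.
Qed.

End binomial_harmonic_poly.

(** * Fundamental theorem of calculus with a singular left endpoint *)

Section FTC_left_open.
Context {R : realType}.
Notation mu := (@lebesgue_measure R).
Variables (f F : R -> R) (a b l : R).
Hypotheses (ab : a < b) (f_ge0 : {in `]a, b], forall x, 0 <= f x}).
Hypothesis cf : {in `]a, +oo[, continuous f}.
Hypothesis dF : {in `]a, +oo[, forall x : R, is_derive x (1 : R) F (f x)}.
Hypothesis Fl : F x @[x --> a^'+] --> l.

Lemma measurable_fun_left_open : measurable_fun `]a, b] f.
Proof.
apply: (@measurable_funS _ _ _ _ `]a, +oo[%classic).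
- exact: measurable_itv.
- by move=> x /=; rewrite !in_itv/= andbT => /andP[].
- apply: open_continuous_measurable_fun; first exact: interval_open.
  by move=> x; rewrite inE/= => /cf.
Qed.

(** The usual theorem applies on each $[u_i, b]$ with $u_i$ decreasing to $a$. The integrals
    converge by monotone convergence, the values $F(b) - F(u_i)$ by the right limit of $F$ at
    $a$. *)
Lemma ge0_FTC2_left_open :
  (\int[mu]_(x in `]a, b]) (f x)%:E = (F b - l)%:E)%E.
Proof.
(* The denominator starts at 2, so that already [u 0] lies strictly below [b]. *)
pose u (i : nat) : R := a + (b - a) * i.+2%:R^-1.
have ba : 0 < b - a by rewrite subr_gt0.
have au i : a < u i by rewrite /u ltrDl mulr_gt0// invr_gt0.
have ub i : u i < b.
  by rewrite /u -ltrBrDl ltr_pdivrMr ?ltr0n// ltr_pMr// ltr1n.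
have u_a : u i @[i --> \oo] --> a.
  rewrite -[X in _ --> X]addr0; apply: cvgD; first exact: cvg_cst.
  rewrite -(mulr0 (b - a)); apply: cvgMr.
  have := @cvg_harmonic R; rewrite -(cvg_shiftS (@harmonic R)).
  exact.
have u_noninc i j : (i <= j)%N -> u j <= u i.
  move=> ij; rewrite /u lerD2l ler_pM2l// lef_pV2 ?posrE ?ltr0n// ler_nat.
  by rewrite !ltnS.
have FTC i : (\int[mu]_(x in `[u i, b]) (f x)%:E = (F b - F (u i))%:E)%E.
  have cF x : a < x -> {for x, continuous F}.
    move=> ax; apply/differentiable_continuous/derivable1_diffP.
    by have [] : is_derive x (1 : R) F (f x) by apply: dF; rewrite in_itv/= ax.
  rewrite EFinB; apply: continuous_FTC2 => //.
  - apply: continuous_in_subspaceT => x; rewrite inE/= in_itv/= => /andP[ux _].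
    by apply: cf; rewrite in_itv/= (lt_le_trans (au i)).
  - split.
    + move=> x; rewrite in_itv/= => /andP[ux _].
      by have [] : is_derive x (1 : R) F (f x)
        by apply: dF; rewrite in_itv/= (lt_trans (au i)).
    + by apply: cvg_at_right_filter; exact: cF.
    + by apply: cvg_at_left_filter; apply: cF.
  - move=> x; rewrite in_itv/= => /andP[ux _].
    rewrite derive1E; apply: derive_val.
    by apply: dF; rewrite in_itv/= (lt_trans (au i)).
have bigcupE : `]a, b]%classic = \bigcup_i `[u i, b]%classic.
  apply/seteqP; split => x /=; last first.
    by move=> [i _] /=; rewrite !in_itv/= => /andP[ux ->]; rewrite (lt_le_trans (au i)).
  rewrite in_itv/= => /andP[ax xb].
  have [N _ /(_ N (leqnn N)) uN] : \forall i \near \oo, u i < x.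
    by move/cvgr_lt : u_a; exact.
  by exists N => //=; rewrite in_itv/= xb andbT ltW.
have cvgI : (\int[mu]_(x in `[u i, b]) (f x)%:E)%E @[i --> \oo] -->
    (\int[mu]_(x in `]a, b]) (f x)%:E)%E.
  rewrite bigcupE; apply: ge0_nondecreasing_set_cvg_integral => //.
  - move=> i j ij; apply/subsetPset => x /=; rewrite !in_itv/= => /andP[ux ->].
    by rewrite andbT (le_trans (u_noninc _ _ ij)).
  - move=> i; apply/measurable_EFinP.
    apply: measurable_funS measurable_fun_left_open => //.
    move=> x /=; rewrite !in_itv/= => /andP[ux ->].
    by rewrite andbT (lt_le_trans (au i)).
  - move=> i x /=; rewrite in_itv/= lee_fin => /andP[ux xb].
    by apply: f_ge0; rewrite in_itv/= xb andbT (lt_le_trans (au i)).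
have : (F b - F (u i))%:E @[i --> \oo] --> (F b - l)%:E.
  apply: cvg_EFin; first exact: nearW.
  apply: cvgB; first exact: cvg_cst.
  by move/cvg_at_rightP : Fl; apply.
under eq_fun do rewrite -FTC.
by apply: cvg_unique cvgI.
Unshelve. all: by end_near. Qed.

(** The integral of [f] is also that of its absolute value, and it has just been found finite. *)
Lemma ge0_integrable_left_open : mu.-integrable `]a, b] (EFin \o f).
Proof.
apply/integrableP; split.
  by apply/measurable_EFinP; exact: measurable_fun_left_open.
under eq_integral => x /[!inE] xab do rewrite /= ger0_norm ?f_ge0//.
by rewrite ge0_FTC2_left_open ltry.
Qed.

End FTC_left_open.

(** * The logarithmic antiderivative and its limit at 0 *)

Section antiderivative.
Context {R : realType}.
Implicit Types t : R.

Lemma is_derive_1DXV k t : 0 < t ->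
  is_derive t (1 : R) (fun x : R => (1 + x) ^- k) (- k%:R * (1 + t) ^- k.+1).
Proof.
move=> t0.
have d1 : is_derive t (1 : R) (fun x : R => 1 + x) 1.
  by rewrite -[X in is_derive _ _ _ X]add0r; apply: is_deriveD.
have u0 : 1 + t != 0 by rewrite gt_eqF// addr_gt0.
have dX := @is_deriveX _ _ _ k _ _ _ d1; rewrite exprfctE in dX.
apply: is_derive_eq.
  by apply: (@is_deriveV _ (fun x : R => (1 + x) ^+ k)); rewrite expf_neq0.
rewrite /GRing.scale/=.
case: k {dX} => [|k]; first by rewrite !(mul0r, mulr0, oppr0).
by rewrite !exprS; field; rewrite u0 expf_neq0.
Qed.

Lemma is_derive_ln1D t : 0 < t ->
  is_derive t (1 : R) (fun x : R => ln (1 + x)) (1 + t)^-1.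
Proof.
move=> t0.
have d1 : is_derive t (1 : R) (fun x : R => 1 + x) 1.
  by rewrite -[X in is_derive _ _ _ X]add0r; apply: is_deriveD.
have dl : is_derive (1 + t) (1 : R) (@ln R) (1 + t)^-1.
  by apply: is_derive1_ln; rewrite addr_gt0.
have := @is_derive1_comp _ (@ln R) (fun x => 1 + x) t _ _ dl d1.
by rewrite mulr1.
Qed.

(** Integration by parts of $(c - \ln t)(1+t)^{-(m+2)}$, the power being integrated to $(1 -
    (1+t)^{-(m+1)})/(m+1)$, whose zero at 0 offsets the logarithm. The last two summands integrate
    the remainder $(1 - (1+t)^{-(m+1)})/t$. *)
Definition log_antideriv (c : R) (m : nat) (t : R) : R :=
  m.+1%:R^-1 * ((1 - (1 + t) ^- m.+1) * (c - ln t) + ln (1 + t) +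
                (1 + t) ^- m * (binomial_harmonic R m).[t]).

Lemma is_derive_log_antideriv c m t : 0 < t ->
  is_derive t (1 : R) (log_antideriv c m) ((c - ln t) / (1 + t) ^+ m.+2).
Proof.
move=> t0.
have dA := @is_deriveB _ _ _ _ _ _ _ _ _
  (is_derive_cst (1 : R) t 1) (is_derive_1DXV m.+1 t t0).
have dB := @is_deriveB _ _ _ _ _ _ _ _ _
  (is_derive_cst c t 1) (is_derive1_ln t0).
have dC := is_derive_ln1D t t0.
have dD := is_deriveM (is_derive_1DXV m t t0)
  (is_derive_poly (binomial_harmonic R m) t).
have dT := is_deriveM (is_derive_cst (m.+1%:R^-1 : R) t 1)
  (is_deriveD (is_deriveD (is_deriveM dA dB) dC) dD).
rewrite (_ : log_antideriv c m = cst m.+1%:R^-1 *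
  ((cst 1 - (fun x : R => (1 + x) ^- m.+1)) * (cst c - @ln R) +
   (fun x : R => ln (1 + x)) +
   (fun x : R => (1 + x) ^- m) * horner (binomial_harmonic R m))); last by [].
apply: (is_derive_eq dT).
have := congr1 (fun p => p.[t]) (binomial_harmonic_deriv R m).
rewrite !hornerE /GRing.scale/=.
(* From here on the polynomial enters only through two scalars tied by the differential equation
   [ode], which is solved for [p'] below. *)
move: (_^`()).[t] => p'; move: (binomial_harmonic R m).[t] => p.
rewrite mulr0 addr0 => ode.
change (m.+1%:R^-1 *
  ((1 - (1 + t) ^- m.+1) * - t^-1 +
   (c - ln t) * - (- m.+1%:R * (1 + t) ^- m.+2) +
   (1 + t)^-1 + (1 + t) ^- m * p' + p * (- m%:R * (1 + t) ^- m.+1)) =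
  (c - ln t) / (1 + t) ^+ m.+2).
have u0 : 1 + t != 0 by rewrite gt_eqF// addr_gt0.
have U0 : (1 + t) ^+ m != 0 by rewrite expf_neq0.
have m0 : m%:R + 1 != 0 :> R by rewrite natr1 pnatr_eq0.
have t1 : t != 0 by rewrite gt_eqF.
have -> : p' = (((1 + t) ^+ m - 1) / t + m%:R * p) / (1 + t).
  by rewrite -ode; field; rewrite u0.
rewrite !exprS -natr1.
move: ((1 + t) ^+ m) U0 (m%:R : R) m0 (ln t) => U U0 M m0 L.
by field; rewrite U0 u0 t1.
Qed.

Lemma continuous_1DXV k t : 0 <= t ->
  {for t, continuous (fun x : R => (1 + x) ^- k)}.
Proof.
move=> t0; apply: cvgV; first by rewrite expf_neq0// gt_eqF// ltr_pwDl.
apply: (@continuous_comp _ _ _ (fun x : R => 1 + x) (fun x : R => x ^+ k)).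
  by apply: cvgD; [exact: cvg_cst|exact: cvg_id].
exact: exprn_continuous.
Qed.

Lemma continuous_log_integrand c k t : 0 < t ->
  {for t, continuous (fun x : R => (c - ln x) / (1 + x) ^+ k)}.
Proof.
move=> t0; apply: cvgM; last exact/continuous_1DXV/ltW.
by apply: cvgB; [exact: cvg_cst|exact: continuous_ln].
Qed.

(** Induction for the upper bound: with $y = (1+t)^{-1}$ and $z = (1+t)^{-n}$, $1 - yz = (1 - z) +
    z(1 - y)$, where $z(1 - y) \le zt \le t$. *)
Lemma one_subXV_le n t : 0 <= t -> 0 <= 1 - (1 + t) ^- n <= n%:R * t.
Proof.
move=> t0; have u1 : 1 <= 1 + t by rewrite lerDl.
have u0 : 0 < 1 + t by rewrite (lt_le_trans ltr01).
have V01 k : 0 <= (1 + t) ^- k <= 1.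
  have uk0 : 0 < (1 + t) ^+ k by rewrite exprn_gt0.
  by rewrite invr_ge0 (ltW uk0)/= invf_le1// exprn_ege1.
have Vt : 1 - (1 + t)^-1 <= t.
  by rewrite lerBlDl -lerBlDr -(ler_pM2r u0) mulVf ?gt_eqF//; nra.
apply/andP; split; first by rewrite subr_ge0; case/andP: (V01 n).
elim: n => [|n IHn]; first by rewrite expr0 invr1 subrr mul0r.
rewrite exprS invfM -natr1.
have /andP[z0 z1] := V01 n.
have := ler_wpM2r z0 Vt; have := ler_wpM2l t0 z1.
move: ((1 + t) ^- n) ((1 + t)^-1) z0 z1 Vt IHn => z y; nra.
Qed.

(** Only the product with $\ln b - \ln x$ is delicate: its other factor is $O(x)$ while the
    logarithm is $O(x^{-1/2})$, so it is squeezed below a multiple of $\sqrt x$. *)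
Lemma cvg_log_antideriv b m : 0 < b ->
  log_antideriv (ln b) m x @[x --> 0^'+] --> 0.
Proof.
move=> b0.
have cD1 : (1 + x : R) @[x --> 0^'+] --> (1 : R).
  apply: cvg_at_right_filter; rewrite -[X in _ --> X]addr0.
  by apply: cvgD; [exact: cvg_cst|exact: cvg_id].
rewrite -[X in _ --> X](mulr0 m.+1%:R^-1); apply: cvgMr.
rewrite -[X in _ --> X]addr0; apply: cvgD.
  rewrite -[X in _ --> X]addr0; apply: cvgD.
    apply: (@squeeze_cvgr _ _ _ _ (cst 0)
      (fun x => m.+1%:R * (2 * Num.sqrt b) * Num.sqrt x)).
    - near=> x.
      have x0 : 0 < x by near: x; exact: nbhs_right_gt.
      have xb : x < b by near: x; exact: nbhs_right_lt.
      have /andP[w0 w1] := one_subXV_le m.+1 x (ltW x0).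
      have sx : 0 < Num.sqrt x by rewrite sqrtr_gt0.
      have sb : 0 < Num.sqrt b by rewrite sqrtr_gt0.
      have xE := sqr_sqrtr (ltW x0).
      have l0 : 0 <= ln b - ln x by rewrite subr_ge0 ler_ln ?posrE// ltW.
      (* $\ln(b/x) = 2 \ln(\sqrt b/\sqrt x) \le 2 \sqrt b/\sqrt x$, by $\ln y < y$. *)
      have l1 : (ln b - ln x) * Num.sqrt x <= 2 * Num.sqrt b.
        rewrite -ln_div ?posrE// -ler_pdivlMr//.
        rewrite -{1}(sqr_sqrtr (ltW b0)) -{1}xE -expr_div_n lnXn ?divr_gt0//.
        rewrite -[leLHS]mulr_natl -mulrA ler_pM2l ?ltr0n//.
        by apply/ltW/ln_sublinear; rewrite divr_gt0.
      rewrite /= mulr_ge0//=.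
      apply: (le_trans (ler_wpM2r l0 w1)).
      have -> : m.+1%:R * x * (ln b - ln x) =
          m.+1%:R * ((ln b - ln x) * Num.sqrt x) * Num.sqrt x.
        by rewrite -{1}xE; ring.
      by rewrite ler_pM2r// ler_pM2l// ltr0n.
    - exact: cvg_cst.
    - rewrite -[X in _ --> X](mulr0 (m.+1%:R * (2 * Num.sqrt b))); apply: cvgMr.
      rewrite -[X in _ --> X]sqrtr0; apply: cvg_at_right_filter; exact: sqrt_continuous.
  rewrite -[X in _ --> X]ln1; apply: continuous_cvg => //.
  exact: continuous_ln.
rewrite -[X in _ --> X](mulr0 ((1 + 0) ^- m)); apply: cvgM.
  by apply: cvg_at_right_filter; exact: continuous_1DXV.
apply: cvg_at_right_filter.
(* The constant term is $H_0$, an empty sum. *)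
have p0 : (binomial_harmonic R m).[0] = 0.
  by rewrite horner_coef0 coef_binomial_harmonic /harmonic_number big_ord0 mulr0.
rewrite -[X in _ --> X]p0.
exact: continuous_horner.
Unshelve. all: by end_near. Qed.

End antiderivative.

Theorem corollary4p5 (R : realType) (b : R) (n : nat)
    (b_gt0 : 0 < b) (n_gt0 : (0 < n)%N) :
  (\int[@lebesgue_measure R]_(t in `]0%R, b])
      (ln t / (1 + t) ^+ n.+1)%:E)%E =
  (n%:R^-1 * (1 - (1 + b) ^- n) * ln b
   - n%:R^-1 * ln (1 + b)
   - (n%:R * (1 + b) ^+ n.-1)^-1 *
     \sum_(1 <= j < n)
       (j`!%:R)^-1 * 'C(n.-1, j)%:R * `|stirling1 j.+1 2|%:~R * b ^+ j)%:E.
Proof.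
case: n n_gt0 => // m _ /=.
pose f t : R := (ln b - ln t) / (1 + t) ^+ m.+2.
pose g t : R := (1 + t) ^- m.+2.
pose G t : R := - m.+1%:R^-1 * (1 + t) ^- m.+1.
have m1 : m.+1%:R != 0 :> R by rewrite pnatr_eq0.
have f_ge0 : {in `]0, b], forall t, 0 <= f t}.
  move=> t; rewrite in_itv/= => /andP[t0 tb].
  rewrite divr_ge0//; last by rewrite exprn_ge0// addr_ge0// ltW.
  by rewrite subr_ge0 ler_ln ?posrE.
have cf : {in `]0, +oo[, continuous f}.
  by move=> t; rewrite in_itv/= andbT => /continuous_log_integrand; exact.
have df : {in `]0, +oo[, forall t : R,
    is_derive t (1 : R) (log_antideriv (ln b) m) (f t)}.
  by move=> t; rewrite in_itv/= andbT => /is_derive_log_antideriv; exact.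
have g_ge0 : {in `]0, b], forall t, 0 <= g t}.
  move=> t; rewrite in_itv/= => /andP[t0 tb].
  by rewrite invr_ge0 exprn_ge0// addr_ge0// ltW.
have cg : {in `]0, +oo[, continuous g}.
  by move=> t; rewrite in_itv/= andbT => /ltW; exact: continuous_1DXV.
have dg : {in `]0, +oo[, forall t : R, is_derive t (1 : R) G (g t)}.
  move=> t; rewrite in_itv/= andbT => t0.
  have dG := is_deriveZ (- m.+1%:R^-1 : R) (is_derive_1DXV m.+1 t t0).
  apply: (is_derive_eq dG).
  by rewrite /GRing.scale/= mulrA mulrNN mulVf// mul1r.
have G0 : G x @[x --> 0^'+] --> (- m.+1%:R^-1 : R).
  apply: cvg_at_right_filter.
  rewrite -[X in _ --> X]mulr1; apply: cvgMr.
  rewrite [X in _ --> X](_ : _ = (1 + 0) ^- m.+1); first exact: continuous_1DXV.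
  by rewrite addr0 expr1n invr1.
have F0 := cvg_log_antideriv b m b_gt0.
(* The integrand may change sign, so it is split into pieces built from the nonnegative [g] and [f];
   their integrability then justifies linearity. *)
transitivity (\int[@lebesgue_measure R]_(t in `]0%R, b])
    ((ln b)%:E * (g t)%:E - (f t)%:E))%E.
  apply: eq_integral => t _; rewrite -EFinM -EFinB /f /g; congr EFin.
  ring.
have ig := ge0_integrable_left_open _ _ _ _ _ b_gt0 g_ge0 cg dg G0.
have iF := ge0_integrable_left_open _ _ _ _ _ b_gt0 f_ge0 cf df F0.
rewrite integralB//=; last exact: integrableZl.
rewrite integralZl// (ge0_FTC2_left_open _ _ _ _ _ b_gt0 g_ge0 cg dg G0).
rewrite (ge0_FTC2_left_open _ _ _ _ _ b_gt0 f_ge0 cf df F0).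
rewrite -EFinM -EFinB subr0; congr EFin.
(* At $t = b$ the factor $\ln b - \ln t$ vanishes, so [f] contributes only $\ln(1+b)$ and the sum;
   the $\ln b$ term comes from [g]. *)
rewrite /log_antideriv /G subrr mulr0 add0r horner_binomial_harmonic.
(* The factor $1/j!$ cancels against $|s(j+1,2)| = j! H_j$. *)
rewrite [in RHS](_ : \sum_(1 <= j < m.+1) _ =
    \sum_(1 <= j < m.+1) 'C(m, j)%:R * harmonic_number R j * b ^+ j); last first.
  apply: eq_bigr => j _; congr (_ * _).
  have j0 : j`!%:R != 0 :> R by rewrite pnatr_eq0 -lt0n fact_gt0.
  by rewrite abs_stirling1S2; field.
have U0 : (1 + b) ^+ m != 0 by rewrite expf_neq0// gt_eqF// addr_gt0.
have V0 : (1 + b) ^+ m.+1 != 0 by rewrite expf_neq0// gt_eqF// addr_gt0.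
by field; rewrite U0 V0 nat1r m1.
Qed.
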